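(* In the noiseless discrete channel setting described in the context, with $(\theta,Y^n,X^n)$ generated by the model and $P_n,Q_n$ as defined there, $$I(\theta;Y^n\mid X^n)=nH(Y)-D(P_n\,\|\,Q_n),$$ and therefore, as $N\to\infty$, $$\left(1-\frac{H(\theta\mid Y^n,X^n)}{H(\theta)}\right)+\frac{D(P_n\,\|\,Q_n)}{H(\theta)}=(1+o(1))\frac{n}{n^*}.$$
   Context: Setting. For each $N\in\mathbb N$: $\Theta=\Theta_N$ is a finite subset of the unit sphere of $\mathbb R^N$ of cardinality $M=M_N$, with $M_N\to\infty$ and $\langle\theta,\theta'\rangle\ge 0$ for all $\theta,\theta'\in\Theta$; $P_\Theta$ is the uniform distribution on $\Theta$; $\mathcal D=\mathcal D_N$ is a distribution on $\mathbb R^{L}$; $g=g_N:\mathbb R^L\times\mathbb R^N\to\mathcal Y$ with $\mathcal Y$ finite of cardinality independent of $N$. One draws $\theta\sim P_\Theta$, independently $X_1,\dots,X_n$ i.i.d. from $\mathcal D$ ($n=n_N$), and sets $Y_i=g(X_i,\theta)$; $Y^n=(Y_i)_{i\le n}$, $X^n=(X_i)_{i\le n}$. $H$ denotes Shannon entropy, $I$ mutual information, $D$ Kullback–Leibler divergence (natural log). $Y$ denotes $g(X,\theta)$ with $X\sim\mathcal D$, $\theta\sim P_\Theta$ independent; $n^*=\lfloor H(\theta)/H(Y)\rfloor$. $P_n$ is the law of $(Y^n,X^n)$ under the model. $Q_n$ is the ''null'' law of $(Y^n,X^n)$ under which $X_1,\dots,X_n$ are i.i.d. from $\mathcal D$ and,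 independently of $X^n$, $Y_1,\dots,Y_n$ are i.i.d. with the law of $Y$. *)

(* Defs.v *)
From HB Require Import structures.
From mathcomp Require Import all_boot all_order all_algebra.
From mathcomp Require Import all_classical all_reals all_analysis.
Set Implicit Arguments. Unset Strict Implicit. Unset Printing Implicit Defensive.
Import Order.TTheory GRing.Theory Num.Theory.
Local Open Scope classical_set_scope.
Local Open Scope ring_scope.

Definition inner (R : realType) (K : nat) (u v : K.-tuple R) : R :=
  \sum_(i < K) tnth u i * tnth v i.

Section Model.
Variables (d : measure_display) (T : measurableType d) (R : realType).
Variable (P : probability T R).
Variables (Th : eqType) (Theta : seq Th).
Variables (Yt : finType) (g : T -> Th -> Yt).

Definition Msz : nat := size Theta.

(* E_{X^n ~ P^n}[f(X^n)] for i.i.d. X_1..X_n, as an iterated integral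
   (for nonnegative measurable f this is the integral against P^{(x) n}). *)
Fixpoint iint (n : nat) : (n.-tuple T -> \bar R) -> \bar R :=
  match n return (n.-tuple T -> \bar R) -> \bar R with
  | 0 => fun f => f [tuple]
  | n'.+1 => fun f => (\int[P]_x iint (fun s : n'.-tuple T => f (cons_tuple x s)))%E
  end.

(* joint pmf of (theta, Y^n) given X^n = xs, at theta = t in Theta
   (theta uniform on Theta, Y_i = g(X_i, theta)). *)
Definition pjoint n (xs : n.-tuple T) (t : Th) (y : n.-tuple Yt) : R :=
  (Msz%:R)^-1 * (val y == map (g ^~ t) xs)%:R.

(* conditional pmf of Y^n given X^n = xs, i.e. density of P_n w.r.t.
   (counting on Y^n) (x) D^n. *)
Definition pYgivenX n (xs : n.-tuple T) (y : n.-tuple Yt) : R :=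
  \sum_(t <- Theta) pjoint xs t y.

Definition MI_at n (xs : n.-tuple T) : R :=
  \sum_(t <- Theta) \sum_(y : n.-tuple Yt)
     pjoint xs t y * ln (pjoint xs t y / ((Msz%:R)^-1 * pYgivenX xs y)).

Definition Hcond_at n (xs : n.-tuple T) : R :=
  \sum_(t <- Theta) \sum_(y : n.-tuple Yt)
     pjoint xs t y * ln (pYgivenX xs y / pjoint xs t y).

Definition condMI n : \bar R := iint (fun xs : n.-tuple T => (MI_at xs)%:E).

Definition condH n : \bar R := iint (fun xs : n.-tuple T => (Hcond_at xs)%:E).

Definition Htheta : R :=
  - \sum_(t <- Theta) (Msz%:R)^-1 * ln ((Msz%:R)^-1).

(* law of Y = g(X, theta), X ~ D, theta ~ Unif(Theta) independent *)
Definition pY (y : Yt) : R :=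
  \sum_(t <- Theta) (Msz%:R)^-1 * fine (P [set x | g x t = y]).

Definition HY : R := - \sum_(y : Yt) pY y * ln (pY y).

Definition nstar : int := Num.floor (Htheta / HY).

Definition klterm (p q : R) : \bar R :=
  if p == 0 then 0%E else if q == 0 then +oo%E else (p * ln (p / q))%:E.

(* D(P_n || Q_n), where P_n has density pYgivenX xs y and Q_n has density
   prod_i pY (y_i) w.r.t. the common dominating measure (counting on Y^n) (x) D^n. *)
Definition KLn n : \bar R :=
  iint (fun xs : n.-tuple T =>
    (\sum_(y : n.-tuple Yt) klterm (pYgivenX xs y) (\prod_(i < n) pY (tnth y i)))%E).

End Model.

(* Main.v *)
(* Every quantity depends on a covariate x only through its pattern
   (g x t)_(t in Theta), which takes finitely many values, so each n-fold
   integral over X^n is a finite sum over sequences of patterns weighted by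
   their probabilities.  Given X^n, the posterior of theta is uniform on the
   parameters consistent with Y^n; hence, pointwise in x,
   H(theta | Y^n, x) + I(theta; Y^n | x) = H(theta), and on patterns of
   positive probability
   I(theta; Y^n | x) + D(P_n(. | x) || Q_n) = - sum_i E_theta ln p_Y(g(x_i, theta)),
   whose mean over X^n is n H(Y).  Finally H(theta) = ln M tends to infinity
   while 0 <= H(Y) <= |Y|, and n^* H(Y) / H(theta) = 1 + O(H(Y) / H(theta)). *)

Require Import Defs.
From HB Require Import structures.
From mathcomp Require Import all_boot all_order all_algebra.
From mathcomp Require Import all_classical all_reals all_analysis.
From mathcomp Require Import measurable_realfun ring lra.
Set Implicit Arguments. Unset Strict Implicit. Unset Printing Implicit Defensive.
Import Order.TTheory GRing.Theory Num.Theory.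
Local Open Scope classical_set_scope.
Local Open Scope ring_scope.

Lemma big_tuple_cons (V : Type) (idx : V) (op : Monoid.com_law idx)
    (S : finType) n (F : n.+1.-tuple S -> V) :
  \big[op/idx]_(s : n.+1.-tuple S) F s =
  \big[op/idx]_(a : S) \big[op/idx]_(s : n.-tuple S) F [tuple of a :: s].
Proof.
rewrite pair_big (reindex (fun p : S * n.-tuple S => [tuple of p.1 :: p.2])) //=.
exists (fun s : n.+1.-tuple S => (thead s, [tuple of behead s])).
- by move=> [a s] _ /=; rewrite theadE; congr pair; apply: val_inj.
- by move=> s _; rewrite [in RHS](tuple_eta s).
Qed.

Section ereal_sums.
Context (R : realType).

Lemma mule_neqNy (r : R) (x : \bar R) : 0 <= r -> x != -oo%E -> (r%:E * x != -oo)%E.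
Proof.
move=> r0; case: x => [x| |] // _.
have [->|rn0] := eqVneq r 0; first by rewrite mul0e.
by rewrite gt0_muley // lte_fin lt0r rn0.
Qed.

Lemma sume_distrr_neqNy (I : Type) (s : seq I) (r : R) (G : I -> \bar R) :
  (forall i, G i != -oo%E) ->
  (r%:E * \sum_(i <- s) G i = \sum_(i <- s) r%:E * G i)%E.
Proof.
move=> G_nNy; apply: fin_num_sume_distrr => // i j _ _.
by case: (G i) (G_nNy i) => [?| |]; case: (G j) (G_nNy j) => [?| |].
Qed.

End ereal_sums.

Section integral_bigsetU.
Local Open Scope ereal_scope.
Context d (T : measurableType d) (R : realType) (mu : {measure set T -> \bar R}).

Lemma integral_bigsetU (I : eqType) (F : I -> set T) (f : T -> \bar R)
    (s : seq I) :
  (forall i, d.-measurable (F i)) ->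
  uniq s -> trivIset [set` s] F ->
  let D := \big[setU/set0]_(i <- s) F i in
  measurable_fun D f ->
  \int[mu]_(x in D) f x = \sum_(i <- s) \int[mu]_(x in F i) f x.
Proof.
move=> mF; elim: s => [|h t ih] us tF D mf.
  by rewrite /D 2!big_nil integral_set0.
have [ht ut] : h \notin t /\ uniq t by move: us => /= /andP.
rewrite /D big_cons integral_setU//.
- rewrite big_cons ih//.
  + by apply: sub_trivIset tF => /= i /= it; rewrite inE it orbT.
  + apply: measurable_funS mf => //; first exact: bigsetU_measurable.
    by rewrite /D big_cons; exact: subsetUr.
- exact: bigsetU_measurable.
- by move: mf; rewrite /D big_cons.
- apply/eqP; rewrite big_distrr/= big_seq big1// => i it.
  move/trivIsetP : tF; apply => //=; rewrite ?mem_head ?inE ?it ?orbT//.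
  by apply: contraNneq ht => ->.
Qed.

End integral_bigsetU.

Lemma ln_prod (R : realType) (I : eqType) (s : seq I) (F : I -> R) :
  (forall i, i \in s -> 0 < F i) ->
  ln (\prod_(i <- s) F i) = \sum_(i <- s) ln (F i).
Proof.
elim: s => [|i s IH] F_gt0; first by rewrite !big_nil ln1.
have F_gt0' j : j \in s -> 0 < F j by move=> js; apply: F_gt0; rewrite inE js orbT.
by rewrite !big_cons lnM ?IH ?posrE ?F_gt0 ?mem_head // big_seq prodr_gt0.
Qed.

Section real_facts.
Context (R : realType).

Lemma entropy_summand_bounds (p : R) : 0 <= p <= 1 -> 0 <= - (p * ln p) <= 1.
Proof.
move=> /andP[p_ge0 p_le1]; have [->|p_neq0] := eqVneq p 0.
  by rewrite mul0r oppr0 lexx ler01.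
have p_gt0 : 0 < p by rewrite lt0r p_neq0.
rewrite oppr_ge0 mulr_ge0_le0 ?ln_le0 //= -mulrN -lnV ?posrE //.
by rewrite -[leRHS](mulfV p_neq0) ler_pM2l // ltW // ln_sublinear ?invr_gt0.
Qed.

(* For [b = 0], [floor (a / b) = 0] and [c / 0 = 0], so the value is irrelevant
   to [floor_ratio_errE]. *)
Definition floor_ratio_err (a b : R) : R :=
  if b == 0 then 0 else b * (Num.floor (a / b))%:~R / a - 1.

Lemma floor_ratio_err_le (a b : R) : 0 < a -> 0 <= b ->
  `|floor_ratio_err a b| <= b / a.
Proof.
move=> a_gt0 b_ge0; rewrite /floor_ratio_err; have [->|b_neq0] := eqVneq b 0.
  by rewrite normr0 mul0r.
have b_gt0 : 0 < b by rewrite lt0r b_neq0.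
set s : R := (Num.floor (a / b))%:~R.
have bs_le : b * s <= a.
  by rewrite -ler_pdivlMl // mulrC floor_le.
have bs_gt : a < b * s + b.
  by rewrite -[X in _ + X]mulr1 -mulrDr -ltr_pdivrMl // -intrD1 mulrC floorD1_gt.
rewrite (_ : _ - 1 = (b * s - a) / a); last by field; rewrite gt_eqF.
rewrite ler_norml -mulNr !ler_pM2r ?invr_gt0 //; lra.
Qed.

Lemma floor_ratio_errE (a b c : R) : 0 < a -> 0 <= b <= a ->
  c * b / a = (1 + floor_ratio_err a b) * (c / (Num.floor (a / b))%:~R).
Proof.
move=> a_gt0 /andP[b_ge0 b_le_a]; rewrite /floor_ratio_err.
have [->|b_neq0] := eqVneq b 0; first by rewrite invr0 !mulr0 floor0 invr0 !mulr0 mul0r.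
have b_gt0 : 0 < b by rewrite lt0r b_neq0.
have s_gt0 : 0 < (Num.floor (a / b))%:~R :> R.
  by rewrite ltr0z floor_gt0 ler_pdivlMr // mul1r.
by rewrite addrC subrK; field; rewrite !gt_eqF.
Qed.

Lemma ln_eventually_ge (s : nat -> nat) :
  (forall m, \forall N \near \oo, (m <= s N)%N) ->
  forall c : R, \forall N \near \oo, c <= ln (s N)%:R.
Proof.
move=> s_oo c; near=> N.
have expc_lt : expR c < (Num.trunc (expR c)).+1%:R by exact: truncnS_gt.
have s_ge : (Num.trunc (expR c)).+1%:R <= (s N)%:R :> R.
  by rewrite ler_nat; near: N; exact: s_oo.
by rewrite -ler_expR lnK ?posrE ?(lt_le_trans (expR_gt0 c)) ?(le_trans (ltW expc_lt)).
Unshelve. all: end_near.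
Qed.

Lemma floor_ratio_err_cvg0 (a b : nat -> R) (K : R) :
  (forall c, \forall N \near \oo, c <= a N) -> (forall N, 0 <= b N < K) ->
  (fun N => floor_ratio_err (a N) (b N)) @ \oo --> 0.
Proof.
move=> a_oo b_range; have K_gt0 : 0 < K.
  by case/andP: (b_range 0%N) => /le_lt_trans; apply.
apply/cvgrPdist_le => e e_gt0; near=> N.
have /andP[b_ge0 b_lt] := b_range N.
have a_ge : K / e <= a N by near: N; exact: a_oo.
have a_gt0 : 0 < a N by apply: (lt_le_trans _ a_ge); rewrite divr_gt0.
rewrite sub0r normrN; apply: le_trans (floor_ratio_err_le a_gt0 b_ge0) _.
rewrite ler_pdivrMr // mulrC; rewrite ler_pdivrMr // mulrC in a_ge; lra.
Unshelve. all: end_near.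
Qed.

End real_facts.

Lemma Htheta_ln (R : realType) (Th : eqType) (Theta : seq Th) :
  (0 < size Theta)%N -> Htheta R Theta = ln (size Theta)%:R.
Proof.
move=> M_gt0; rewrite /Htheta big_const_seq count_predT iter_addr_0 /Msz.
have M_neq0 : (size Theta)%:R != 0 :> R by rewrite pnatr_eq0 -lt0n.
set M := (size Theta)%:R in M_neq0 *.
by rewrite -mulr_natl mulrA mulfV // mul1r lnV ?posrE ?invr_gt0 ?ltr0n // opprK.
Qed.

Lemma Htheta_eventually_ge (R : realType) (Th : nat -> eqType)
    (Theta : forall N, seq (Th N)) :
  (forall m, \forall N \near \oo, (m <= size (Theta N))%N) ->
  forall c : R, \forall N \near \oo, c <= Htheta R (Theta N).
Proof.
move=> size_oo c; near=> N; rewrite Htheta_ln.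
  by near: N; exact: (ln_eventually_ge size_oo).
by near: N; exact: size_oo.
Unshelve. all: end_near.
Qed.

Section finite_valued_map.
Context d (T : measurableType d) (R : realType) (P : probability T R).
Context (F : finType) (f : T -> F).
Hypothesis mf : forall a, measurable (f @^-1` [set a]).

Definition fmass (a : F) : R := fine (P (f @^-1` [set a])).

Definition tmass n (s : n.-tuple F) : R := \prod_(a <- s) fmass a.

Definition fsection (a : F) : T := xget point (f @^-1` [set a]).

Lemma fmassE a : P (f @^-1` [set a]) = (fmass a)%:E.
Proof. by rewrite fineK// fin_num_measure. Qed.

Lemma fmass_ge0 a : 0 <= fmass a.
Proof. exact: fine_ge0. Qed.

Lemma tmass_ge0 n (s : n.-tuple F) : 0 <= tmass s.
Proof. by apply: prodr_ge0 => a _; exact: fmass_ge0. Qed.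

Lemma tmass_cons n a (s : n.-tuple F) : tmass [tuple of a :: s] = fmass a * tmass s.
Proof. exact: big_cons. Qed.

Lemma fsectionK x : f (fsection (f x)) = f x.
Proof. by have := xgetPex point (ex_intro _ x erefl : exists y, (f @^-1` [set f x]) y). Qed.

Lemma fmass_neq0_fsection a : fmass a != 0 -> f (fsection a) = a.
Proof.
move=> ma; apply: (@xgetPex _ point (f @^-1` [set a])).
apply/set0P; move: ma; apply: contra_neq => fa0.
by rewrite /fmass fa0 measure0.
Qed.

Lemma measurable_fun_comp_fin (G : F -> \bar R) (D : set T) :
  measurable_fun D (G \o f).
Proof.
move=> mD B mB; apply: measurableI => //.
rewrite (_ : _ @^-1` _ = \bigcup_(a in [set a | B (G a)]) f @^-1` [set a]).
  by apply: fin_bigcup_measurable => //; exact: finite_finset.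
by apply/seteqP; split => [x Bx|x [a Ba /= fxa]]; [exists (f x)|rewrite /= fxa].
Qed.

Lemma integral_comp_fin (G : F -> \bar R) :
  (\int[P]_x G (f x) = \sum_a (fmass a)%:E * G a)%E.
Proof.
have -> : [set: T] = \big[setU/set0]_(a <- index_enum F) f @^-1` [set a].
  apply/seteqP; split => x // _; rewrite -bigcup_seq.
  by exists (f x); rewrite //= mem_index_enum.
rewrite integral_bigsetU //; first last.
- exact: measurable_fun_comp_fin.
- apply/trivIsetP => a b _ _ ab; apply/seteqP; split => // x [/= fa fb].
  by rewrite -fa -fb eqxx in ab.
- exact: index_enum_uniq.
apply: eq_bigr => a _; rewrite muleC -fmassE -integral_cst//.
by apply: eq_integral => x; rewrite inE => ->.
Qed.

Lemma sum_fmass : \sum_a fmass a = 1.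
Proof.
apply: EFin_inj; rewrite -sumEFin.
under eq_bigr do rewrite -[(fmass _)%:E]mule1.
by rewrite -(integral_comp_fin (cst 1%E)) integral_cst//= mul1e probability_setT.
Qed.

Lemma sum_tmass n : \sum_(s : n.-tuple F) tmass s = 1.
Proof.
elim: n => [|n IH].
  rewrite (big_pred1 [tuple]) ?/tmass ?big_nil // => s.
  by apply/esym/eqP; exact: tuple0.
rewrite big_tuple_cons -[RHS]sum_fmass; apply: eq_bigr => a _.
under eq_bigr do rewrite tmass_cons.
by rewrite -mulr_sumr IH mulr1.
Qed.

Lemma sum_tmass_sum n (h : F -> R) :
  \sum_(s : n.-tuple F) tmass s * \sum_(a <- s) h a =
  n%:R * \sum_a fmass a * h a.
Proof.
elim: n => [|n IH].
  by rewrite mul0r big1 // => s _; rewrite tuple0 big_nil mulr0.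
rewrite big_tuple_cons mulrS mulrDl mul1r -IH -[X in _ = _ + X]mul1r -sum_fmass.
rewrite big_distrl -big_split /=.
apply: eq_bigr => a _.
transitivity (\sum_(s : n.-tuple F)
    (fmass a * h a * tmass s + fmass a * (tmass s * \sum_(b <- s) h b))).
  by apply: eq_bigr => s _; rewrite tmass_cons big_cons; ring.
by rewrite big_split /= -!big_distrr /= sum_tmass mulr1.
Qed.

Lemma iint_comp_map n (Phi : n.-tuple F -> \bar R) :
  (forall s, Phi s != -oo%E) ->
  iint P (fun xs => Phi (map_tuple f xs)) = (\sum_s (tmass s)%:E * Phi s)%E.
Proof.
elim: n Phi => [|n IH] Phi Phi_fin /=.
  rewrite (big_pred1 [tuple]) /tmass ?big_nil ?mul1e => [|s]; last first.
    by apply/esym/eqP; exact: tuple0.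
  by congr Phi; exact: tuple0.
transitivity (\int[P]_x (\sum_(s : n.-tuple F)
    (tmass s)%:E * Phi [tuple of f x :: s]))%E.
  apply: eq_integral => x _; rewrite -IH //.
  by congr iint; apply: funext => xs; congr Phi; apply: val_inj.
rewrite (integral_comp_fin (fun a => \sum_(s : n.-tuple F)
    (tmass s)%:E * Phi [tuple of a :: s])%E) big_tuple_cons.
apply: eq_bigr => a _; rewrite sume_distrr_neqNy => [|s]; last first.
  by apply: mule_neqNy => //; exact: tmass_ge0.
by apply: eq_bigr => s _; rewrite tmass_cons EFinM muleA.
Qed.

Lemma iint_invariant n (Fn : n.-tuple T -> \bar R) :
  (forall xs ys, map_tuple f xs = map_tuple f ys -> Fn xs = Fn ys) ->
  (forall xs, Fn xs != -oo%E) ->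
  iint P Fn = (\sum_s (tmass s)%:E * Fn (map_tuple fsection s))%E.
Proof.
move=> Finv Fn_nNy; rewrite -iint_comp_map //; congr iint.
apply: funext => xs; apply: Finv; apply: val_inj => /=.
by rewrite -!map_comp; apply: eq_map => x /=; rewrite fsectionK.
Qed.

Lemma integral_invariant (phi : T -> R) :
  (forall x y, f x = f y -> phi x = phi y) ->
  (\int[P]_x (phi x)%:E = (\sum_a fmass a * phi (fsection a))%:E)%E.
Proof.
move=> phi_inv; transitivity (\int[P]_x (phi (fsection (f x)))%:E)%E.
  by apply: eq_integral => x _; rewrite (phi_inv x (fsection (f x))) ?fsectionK.
rewrite (integral_comp_fin (fun a => (phi (fsection a))%:E)) -sumEFin.
by under eq_bigr do rewrite -EFinM.
Qed.

Lemma iint_sum_coords n (phi : T -> R) :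
  (forall x y, f x = f y -> phi x = phi y) ->
  iint P (fun xs : n.-tuple T => (\sum_(x <- xs) phi x)%:E) =
  (n%:R%:E * \int[P]_x (phi x)%:E)%E.
Proof.
move=> phi_inv; pose h a := phi (fsection a).
have phiE x : phi x = h (f x) by apply: phi_inv; rewrite fsectionK.
rewrite (_ : (fun xs => _) = fun xs => (\sum_(a <- map_tuple f xs) h a)%:E); last first.
  by apply: funext => xs /=; rewrite big_map; under eq_bigr do rewrite phiE.
rewrite (iint_comp_map (Phi := fun s : n.-tuple F => (\sum_(a <- s) h a)%:E)) //.
rewrite integral_invariant // -EFinM -sum_tmass_sum -sumEFin.
by under eq_bigr do rewrite -EFinM.
Qed.

Lemma iint_invariant_EFin n (r : n.-tuple T -> R) :
  (forall xs ys, map_tuple f xs = map_tuple f ys -> r xs = r ys) ->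
  iint P (fun xs => (r xs)%:E) = (\sum_s tmass s * r (map_tuple fsection s))%:E.
Proof.
move=> r_inv; rewrite (iint_invariant (Fn := fun xs => (r xs)%:E)) => [|xs ys /r_inv ->|] //.
by rewrite -sumEFin; under [in RHS]eq_bigr do rewrite EFinM.
Qed.

Lemma tmass_neq0_fsection n (s : n.-tuple F) x :
  tmass s != 0 -> x \in map_tuple fsection s -> fmass (f x) != 0.
Proof.
rewrite /tmass prodf_seq_neq0 => /allP s_neq0 /mapP[a /s_neq0 a_neq0 ->].
by rewrite fmass_neq0_fsection.
Qed.

End finite_valued_map.

Section model.
Context d (T : measurableType d) (R : realType) (P : probability T R).
Context (Th : eqType) (Theta : seq Th) (Yt : finType) (g : T -> Th -> Yt).
Local Notation M := (Msz Theta).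
Local Notation m := ((Msz Theta)%:R^-1 : R).
Local Notation pjoint := (pjoint R Theta g).
Local Notation pYgivenX := (pYgivenX R Theta g).
Local Notation pY := (pY P Theta g).
Hypothesis mg : forall t, t \in Theta -> forall y, measurable [set x | g x t = y].

Definition obs n (xs : n.-tuple T) (t : Th) : n.-tuple Yt := map_tuple (g ^~ t) xs.

Definition pYn n (y : n.-tuple Yt) : R := \prod_(i < n) pY (tnth y i).

Definition KL_at n (xs : n.-tuple T) : \bar R :=
  (\sum_(y : n.-tuple Yt) klterm (pYgivenX xs y) (pYn y))%E.

Lemma KL_at_neqNy n (xs : n.-tuple T) : KL_at xs != -oo%E.
Proof.
rewrite esum_eqNy negb_exists; apply/forallP => y /=.
by rewrite /klterm; case: ifP => //; case: ifP.
Qed.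

Lemma Msz_gt0 t : t \in Theta -> 0 < M%:R :> R.
Proof. by rewrite ltr0n /Msz; case: Theta. Qed.

Lemma pjointE n (xs : n.-tuple T) t y : pjoint xs t y = m * (y == obs xs t)%:R.
Proof. by []. Qed.

Lemma pjoint_ge0 n (xs : n.-tuple T) t y : 0 <= pjoint xs t y.
Proof. by rewrite pjointE mulr_ge0 ?invr_ge0. Qed.

Lemma sum_pjoint n (xs : n.-tuple T) t (G : n.-tuple Yt -> R -> R) :
  \sum_y pjoint xs t y * G y (pjoint xs t y) = m * G (obs xs t) m.
Proof.
rewrite (bigD1 (obs xs t)) //= big1 ?addr0 => [|y /negbTE yo].
  by rewrite pjointE eqxx mulr1.
by rewrite pjointE yo mulr0 mul0r.
Qed.

Lemma sum_pYgivenX n (xs : n.-tuple T) (h : n.-tuple Yt -> R) :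
  \sum_y pYgivenX xs y * h y = \sum_(t <- Theta) m * h (obs xs t).
Proof.
under eq_bigr do rewrite big_distrl.
rewrite exchange_big; apply: eq_bigr => t _ /=.
exact: (sum_pjoint xs t (fun y _ => h y)).
Qed.

Lemma pYgivenX_obs_gt0 n (xs : n.-tuple T) t :
  t \in Theta -> 0 < pYgivenX xs (obs xs t).
Proof.
move=> tT; rewrite /pYgivenX (big_rem t tT) /= pjointE eqxx mulr1.
rewrite ltr_wpDr ?invr_gt0 ?(Msz_gt0 tT) //.
by apply: sumr_ge0 => u _; exact: pjoint_ge0.
Qed.

Lemma Hcond_at_add_MI_at n (xs : n.-tuple T) :
  Hcond_at R Theta g xs + MI_at R Theta g xs = Htheta R Theta.
Proof.
rewrite /Hcond_at /MI_at -big_split /Htheta -sumrN; apply: eq_big_seq => t tT /=.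
rewrite -big_split /=; under eq_bigr do rewrite -mulrDr.
rewrite (sum_pjoint xs t (fun y p => ln (pYgivenX xs y / p) +
                                     ln (p / (m * pYgivenX xs y)))).
have M_gt0 := Msz_gt0 tT; have p_gt0 := pYgivenX_obs_gt0 xs tT.
rewrite -lnM ?posrE ?divr_gt0 ?mulr_gt0 ?invr_gt0 //.
rewrite (_ : _ / m * _ = m^-1); last by field; rewrite !gt_eqF.
by rewrite lnV ?posrE ?invr_gt0 // mulrN.
Qed.

Definition avg_ln_pY (x : T) : R := \sum_(t <- Theta) m * ln (pY (g x t)).

Lemma MI_atE n (xs : n.-tuple T) :
  MI_at R Theta g xs = \sum_(t <- Theta) m * - ln (pYgivenX xs (obs xs t)).
Proof.
apply: eq_big_seq => t tT.
rewrite (sum_pjoint xs t (fun y p => ln (p / (m * pYgivenX xs y)))).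
have M_gt0 := Msz_gt0 tT; have p_gt0 := pYgivenX_obs_gt0 xs tT.
rewrite (_ : m / _ = (pYgivenX xs (obs xs t))^-1) ?lnV ?posrE //.
by field; rewrite !gt_eqF.
Qed.

Lemma KL_atE n (xs : n.-tuple T) :
  (forall t, t \in Theta -> pYn (obs xs t) != 0) ->
  KL_at xs =
  (\sum_(t <- Theta) m * ln (pYgivenX xs (obs xs t) / pYn (obs xs t)))%:E.
Proof.
move=> q_neq0; rewrite -(sum_pYgivenX xs (fun y => ln (pYgivenX xs y / pYn y))).
rewrite -sumEFin; apply: eq_bigr => y _.
rewrite /klterm; have [->|p_neq0] := eqVneq (pYgivenX xs y) 0; first by rewrite mul0r.
have /hasP[t tT /eqP ->] : has (fun t => y == obs xs t) Theta.
  apply: contraNT p_neq0 => /hasPn yo; rewrite /pYgivenX big_seq big1 // => t tT.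
  by rewrite pjointE (negbTE (yo t tT)) mulr0.
by rewrite (negbTE (q_neq0 t tT)).
Qed.

Lemma ln_pYn_obs n (xs : n.-tuple T) t :
  (forall x, x \in xs -> 0 < pY (g x t)) ->
  ln (pYn (obs xs t)) = \sum_(x <- xs) ln (pY (g x t)).
Proof.
move=> pY_gt0; rewrite -ln_prod // big_tuple /pYn.
by under eq_bigr do rewrite tnth_map.
Qed.

Lemma MI_at_add_KL_at n (xs : n.-tuple T) :
  (forall x t, x \in xs -> t \in Theta -> 0 < pY (g x t)) ->
  ((MI_at R Theta g xs)%:E + KL_at xs = (- \sum_(x <- xs) avg_ln_pY x)%:E)%E.
Proof.
move=> pY_gt0.
have q_gt0 t : t \in Theta -> 0 < pYn (obs xs t).
  move=> tT; apply: prodr_gt0 => i _; rewrite tnth_map.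
  by apply: pY_gt0 => //; exact: mem_tnth.
rewrite KL_atE => [|t tT]; last by rewrite gt_eqF ?q_gt0.
rewrite MI_atE -EFinD -big_split /= /avg_ln_pY exchange_big -sumrN /=.
congr EFin; apply: eq_big_seq => t tT.
rewrite -mulrDr ln_div ?posrE ?pYgivenX_obs_gt0 ?q_gt0 //.
rewrite ln_pYn_obs => [|x xxs]; last exact: pY_gt0.
by rewrite addKr mulrN big_distrr.
Qed.

Lemma pY_ge0 y : 0 <= pY y.
Proof. by apply: sumr_ge0 => t _; rewrite mulr_ge0 ?invr_ge0 ?fine_ge0. Qed.

Lemma pY_le1 y : pY y <= 1.
Proof.
apply: (@le_trans _ _ (\sum_(t <- Theta) m)).
  rewrite /pY !big_seq; apply: ler_sum => t tT; have mt := mg tT y.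
  by rewrite ler_piMr ?invr_ge0 // -lee_fin fineK ?fin_num_measure ?probability_le1.
rewrite big_const_seq count_predT iter_addr_0 /Msz -(mulr_natl (size Theta)%:R^-1).
by case: (size Theta) => [|k]; rewrite ?mul0r ?ler01 // mulfV.
Qed.

Lemma HY_bounds : 0 <= HY P Theta g <= #|Yt|%:R.
Proof.
have pY_bounds y : 0 <= - (pY y * ln (pY y)) <= 1.
  by apply: entropy_summand_bounds; rewrite pY_ge0 pY_le1.
rewrite /HY -sumrN sumr_ge0 => [|y _]; last by case/andP: (pY_bounds y).
apply: (@le_trans _ _ (\sum_(y : Yt) 1)); last by rewrite sumr_const.
by apply: ler_sum => y _; case/andP: (pY_bounds y).
Qed.

Definition pattern (x : T) : M.-tuple Yt := map_tuple (g x) (in_tuple Theta).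

Lemma factor_pattern t : t \in Theta ->
  exists phi : M.-tuple Yt -> Yt, forall x, phi (pattern x) = g x t.
Proof.
move=> tT; exists (fun a => nth (g point t) a (index t Theta)) => x.
by rewrite (nth_map t) ?index_mem // nth_index.
Qed.

Lemma measurable_pattern_fiber a : measurable (pattern @^-1` [set a]).
Proof.
have -> : pattern @^-1` [set a] = \bigcap_(i in [set: 'I_M])
    [set x | g x (tnth (in_tuple Theta) i) = tnth a i].
  apply/seteqP; split => [x /= <- i _|x /= ga]; first by rewrite tnth_map.
  by apply: eq_from_tnth => i; rewrite tnth_map ga.
by apply: fin_bigcap_measurable => // i _; apply: mg; exact: mem_tnth.
Qed.

Local Notation fmass := (fmass P pattern).
Local Notation fsection := (fsection pattern).

Lemma obs_pattern n (xs ys : n.-tuple T) t :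
  map_tuple pattern xs = map_tuple pattern ys -> t \in Theta -> obs xs t = obs ys t.
Proof.
move=> xy tT; have [phi phiE] := factor_pattern tT.
apply: eq_from_tnth => i; rewrite !tnth_map -!phiE.
by have := congr1 (fun s => tnth s i) xy; rewrite !tnth_map => ->.
Qed.

Lemma pYgivenX_pattern n (xs ys : n.-tuple T) :
  map_tuple pattern xs = map_tuple pattern ys ->
  pYgivenX xs =1 pYgivenX ys.
Proof.
by move=> xy y; apply: eq_big_seq => t tT; rewrite !pjointE (obs_pattern xy tT).
Qed.

Lemma MI_at_pattern n (xs ys : n.-tuple T) :
  map_tuple pattern xs = map_tuple pattern ys ->
  MI_at R Theta g xs = MI_at R Theta g ys.
Proof.
move=> xy; apply: eq_big_seq => t tT; apply: eq_bigr => y _.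
by rewrite !pjointE (obs_pattern xy tT) (pYgivenX_pattern xy).
Qed.

Lemma Hcond_at_pattern n (xs ys : n.-tuple T) :
  map_tuple pattern xs = map_tuple pattern ys ->
  Hcond_at R Theta g xs = Hcond_at R Theta g ys.
Proof.
move=> xy; apply: eq_big_seq => t tT; apply: eq_bigr => y _.
by rewrite !pjointE (obs_pattern xy tT) (pYgivenX_pattern xy).
Qed.

Lemma KL_at_pattern n (xs ys : n.-tuple T) :
  map_tuple pattern xs = map_tuple pattern ys ->
  KL_at xs = KL_at ys.
Proof. by move=> xy; apply: eq_bigr => y _; rewrite (pYgivenX_pattern xy). Qed.

Lemma avg_ln_pY_pattern x x' :
  pattern x = pattern x' -> avg_ln_pY x = avg_ln_pY x'.
Proof.
move=> xx'; apply: eq_big_seq => t tT; have [phi phiE] := factor_pattern tT.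
by rewrite -!phiE xx'.
Qed.

Lemma pY_gt0 x t : fmass (pattern x) != 0 -> t \in Theta -> 0 < pY (g x t).
Proof.
move=> px_neq0 tT; have [phi phiE] := factor_pattern tT.
have px_le : fmass (pattern x) <= fine (P [set z | g z t = g x t]).
  have [mp mt] := (measurable_pattern_fiber (pattern x), mg tT (g x t)).
  rewrite fine_le ?fin_num_measure //; apply: le_measure; rewrite ?inE //.
  by move=> z /= zx; rewrite -!phiE zx.
rewrite /pY (big_rem t tT) /= ltr_wpDr ?mulr_gt0 ?invr_gt0 ?(Msz_gt0 tT) //.
  by apply: sumr_ge0 => t' _; rewrite mulr_ge0 ?invr_ge0 ?fine_ge0.
by apply: (lt_le_trans _ px_le); rewrite lt0r px_neq0 fmass_ge0.
Qed.

Lemma sum_fmass_pattern t (G : Yt -> R) : t \in Theta ->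
  \sum_a fmass a * G (g (fsection a) t) =
  \sum_y fine (P [set x | g x t = y]) * G y.
Proof.
move=> tT; have [phi phiE] := factor_pattern tT.
have G_inv x y : pattern x = pattern y -> G (g x t) = G (g y t).
  by move=> xy; rewrite -!phiE xy.
apply: EFin_inj; rewrite -(integral_invariant P measurable_pattern_fiber G_inv).
rewrite (integral_comp_fin P (f := g ^~ t) (mg tT) (fun y => (G y)%:E)).
by rewrite -sumEFin; under [in RHS]eq_bigr do rewrite EFinM.
Qed.

Lemma integral_avg_ln_pY :
  (\int[P]_x (avg_ln_pY x)%:E = (- HY P Theta g)%:E)%E.
Proof.
rewrite (integral_invariant P measurable_pattern_fiber avg_ln_pY_pattern).
congr EFin; rewrite /avg_ln_pY /HY opprK.
under eq_bigr do rewrite big_distrr /=.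
rewrite exchange_big /=.
transitivity (\sum_(t <- Theta) m * \sum_y fine (P [set x | g x t = y]) * ln (pY y)).
  apply: eq_big_seq => t tT; rewrite -(sum_fmass_pattern (fun y => ln (pY y)) tT).
  by rewrite big_distrr; apply: eq_bigr => a _; rewrite mulrCA.
rewrite (eq_bigr _ (fun t _ => big_distrr _ _ _)) exchange_big /=.
apply: eq_bigr => y _.
by rewrite /pY big_distrl; apply: eq_bigr => t _; rewrite mulrA.
Qed.

Definition mean_MI n : R :=
  \sum_(s : n.-tuple (M.-tuple Yt)) tmass P pattern s * MI_at R Theta g (map_tuple fsection s).

Lemma condMIE n : condMI P Theta g n = (mean_MI n)%:E.
Proof. exact: (iint_invariant_EFin P measurable_pattern_fiber (MI_at_pattern (n := n))). Qed.

Lemma condHE n : condH P Theta g n = (Htheta R Theta - mean_MI n)%:E.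
Proof.
have mp := measurable_pattern_fiber.
rewrite /condH (iint_invariant_EFin P mp (Hcond_at_pattern (n := n))); congr EFin.
rewrite -[Htheta R Theta]mulr1 -(sum_tmass P mp n) mulr_sumr -sumrB.
by apply: eq_bigr => s _; rewrite -(Hcond_at_add_MI_at (map_tuple fsection s)); ring.
Qed.

Lemma sum_avg_ln_pY_pattern n (xs ys : n.-tuple T) :
  map_tuple pattern xs = map_tuple pattern ys ->
  \sum_(x <- xs) avg_ln_pY x = \sum_(x <- ys) avg_ln_pY x.
Proof.
move=> xy; rewrite !big_tuple; apply: eq_bigr => i _; apply: avg_ln_pY_pattern.
by have := congr1 (fun s => tnth s i) xy; rewrite !tnth_map.
Qed.

Lemma iint_sum_avg_ln_pY n :
  iint P (fun xs : n.-tuple T => (\sum_(x <- xs) avg_ln_pY x)%:E) =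
  (- (n%:R * HY P Theta g))%:E.
Proof.
rewrite (iint_sum_coords P measurable_pattern_fiber n avg_ln_pY_pattern).
by rewrite integral_avg_ln_pY -EFinM mulrN.
Qed.

Lemma KL_at_fsection n (s : n.-tuple (M.-tuple Yt)) :
  tmass P pattern s != 0 ->
  let xs := map_tuple fsection s in
  KL_at xs = (- \sum_(x <- xs) avg_ln_pY x - MI_at R Theta g xs)%:E.
Proof.
move=> s_neq0 xs.
have pY_xs_gt0 x t : x \in xs -> t \in Theta -> 0 < pY (g x t).
  by move=> x_xs tT; apply: pY_gt0 tT; exact: tmass_neq0_fsection s_neq0 x_xs.
rewrite -[KL_at xs](@addeK _ (MI_at R Theta g xs)%:E) // [X in (X - _)%E]addeC.
by rewrite MI_at_add_KL_at // EFinB.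
Qed.

Lemma KLnE n : KLn P Theta g n = (n%:R * HY P Theta g - mean_MI n)%:E.
Proof.
have mp := measurable_pattern_fiber.
rewrite [KLn _ _ _ _](iint_invariant P mp (KL_at_pattern (n := n)) (KL_at_neqNy (n := n))).
transitivity (\sum_(s : n.-tuple (M.-tuple Yt)) (tmass P pattern s *
    (- \sum_(x <- map_tuple fsection s) avg_ln_pY x
     - MI_at R Theta g (map_tuple fsection s)))%:E)%E.
  apply: eq_bigr => s _; have [->|s_neq0] := eqVneq (tmass P pattern s) 0.
    by rewrite mul0e mul0r.
  by rewrite KL_at_fsection // EFinM.
rewrite sumEFin; congr EFin; under eq_bigr do rewrite mulrBr mulrN.
have := iint_sum_avg_ln_pY n.
rewrite (iint_invariant_EFin P mp (sum_avg_ln_pY_pattern (n := n))) => -[avgE].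
by rewrite sumrB sumrN avgE opprK.
Qed.

Lemma condMI_eq n :
  condMI P Theta g n = ((n%:R * HY P Theta g)%:E - KLn P Theta g n)%E.
Proof. by rewrite condMIE KLnE -EFinB opprB addrC subrK. Qed.

Lemma information_ratio n : Htheta R Theta != 0 ->
  ((1%:E - condH P Theta g n * ((Htheta R Theta)^-1)%:E)
   + KLn P Theta g n * ((Htheta R Theta)^-1)%:E
   = (n%:R * HY P Theta g / Htheta R Theta)%:E)%E.
Proof.
move=> Ht_neq0; rewrite condHE KLnE -!EFinM -EFinB -EFinD.
by congr EFin; field.
Qed.

End model.

Theorem proposition3 (R : realType) (Yt : finType)
  (L n : nat -> nat)
  (Theta : forall N : nat, seq (N.-tuple R))
  (D : forall N : nat, probability ((L N).-tuple R) R)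
  (g : forall N : nat, (L N).-tuple R -> N.-tuple R -> Yt) :
  (forall N, uniq (Theta N)) ->
  (forall N, forall t, t \in Theta N -> inner t t = 1) ->
  (forall N, forall t t', t \in Theta N -> t' \in Theta N -> 0 <= inner t t') ->
  (forall m : nat, \forall N \near \oo, (m <= size (Theta N))%N) ->
  (forall N, forall t, t \in Theta N -> forall y : Yt,
      measurable [set x | g N x t = y]) ->
  (forall N,
     condMI (D N) (Theta N) (g N) (n N)
     = ((n N)%:R * HY (D N) (Theta N) (g N))%:E - KLn (D N) (Theta N) (g N) (n N))%E
  /\
  (exists eps : nat -> R, eps @ \oo --> 0 /\
     \forall N \near \oo,
       ((1%:E - condH (D N) (Theta N) (g N) (n N) * ((Htheta R (Theta N))^-1)%:E)
        + KLn (D N) (Theta N) (g N) (n N) * ((Htheta R (Theta N))^-1)%:E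
        = ((1 + eps N) * ((n N)%:R / (nstar (D N) (Theta N) (g N))%:~R))%:E)%E).
Proof.
move=> _ _ _ size_oo mg; split => [N|]; first exact: condMI_eq (mg N) (n N).
pose K : R := #|Yt|%:R + 1.
have HY_range N : 0 <= HY (D N) (Theta N) (g N) < K.
  by have := HY_bounds (D N) (mg N); rewrite /K; lra.
have Ht_oo : forall c : R, \forall N \near \oo, c <= Htheta R (Theta N).
  exact: Htheta_eventually_ge.
exists (fun N => floor_ratio_err (Htheta R (Theta N)) (HY (D N) (Theta N) (g N))).
split; first exact: (floor_ratio_err_cvg0 Ht_oo HY_range).
near=> N; have /andP[HY_ge0 HY_lt] := HY_range N.
have Ht_ge : K <= Htheta R (Theta N) by near: N; exact: Ht_oo.
have Ht_gt0 : 0 < Htheta R (Theta N) by lra.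
rewrite (information_ratio (D N) (mg N)) ?gt_eqF // -floor_ratio_errE // HY_ge0 /=; lra.
Unshelve. all: end_near.
Qed.
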